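(* Let $A\in\mathcal{PC}_{n}$ and suppose that $\mathcal{E}(A)$ is convex. Then both the Perron vector of $AA^{T}$ and the right Perron vector of $A$ lie in $\mathcal{E}(A)$.
   Context: An $n$-by-$n$ entrywise positive real matrix $A=[a_{ij}]$ is reciprocal if $a_{ji}=1/a_{ij}$ for all $1\le i,j\le n$ (so diagonal entries are $1$); $\mathcal{PC}_n$ denotes the set of such matrices. For an entrywise positive vector $w\in\mathbb{R}^n$, $w^{(-T)}$ is the row vector with entries $1/w_j$, so $ww^{(-T)}=[w_i/w_j]$. A positive vector $w\in\mathbb{R}^n$ is efficient for $A\in\mathcal{PC}_n$ if for every positive vector $v\in\mathbb{R}^n$, the entrywise inequality $|A-vv^{(-T)}|\le |A-ww^{(-T)}|$ (entrywise absolute values) implies that $v$ is proportional to $w$. $\mathcal{E}(A)$ denotes the set of all positive vectors efficient for $A$. The (right) Perron vector of an entrywise positive square matrix $M$ is the entrywise positive (right) eigenvector of $M$ associated with its spectral radius $\rho(M)$; it is unique up to a positive scalar factor. *)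

(* Defs.v *)
From mathcomp Require Import all_boot all_order all_algebra.
From mathcomp Require Import complex.
From mathcomp Require Import boolp classical_sets reals convex.

Set Implicit Arguments.
Unset Strict Implicit.
Unset Printing Implicit Defensive.

Import Order.TTheory GRing.Theory Num.Theory.

Local Open Scope classical_set_scope.
Local Open Scope ring_scope.
Local Open Scope complex_scope.

Section Efficiency.
Variables (R : realType) (n : nat).
Implicit Types (A M : 'M[R]_n) (v w : 'cV[R]_n).

Definition reciprocal_mx A : Prop :=
  (forall i j, 0 < A i j) /\ (forall i j, A j i = 1 / A i j).

Definition vec_pos w : Prop := forall i, 0 < w i 0.

(* The row vector $w^{(-T)}$, so that [(w *m invT w) i j = w i 0 / w j 0]. *)
Definition invT w : 'rV[R]_n := \row_j (w j 0)^-1.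

Definition proportional v w : Prop := exists c : R, v = c *: w.

Definition efficient A w : Prop :=
  vec_pos w /\
  forall v, vec_pos v ->
    (forall i j, `|(A - v *m invT v) i j| <= `|(A - w *m invT w) i j|) ->
    proportional v w.

Definition efficient_set A : set 'cV[R]_n := [set w | efficient A w].

(* All complex eigenvalues count. The library's [eigenvalue] is phrased with
   row vectors, which gives the same spectrum as column vectors. The set below
   is finite, and nonempty for [0 < n], so that the supremum is a maximum. *)
Definition spectral_radius M : R :=
  sup [set ComplexField.Normc.normc z |
        z in [set z : R[i] | eigenvalue (map_mx (real_complex R) M) z]].

Definition perron_vector M w : Prop :=
  vec_pos w /\ M *m w = spectral_radius M *: w.

End Efficiency.

(* Main.v *)
Require Import Defs.
From mathcomp Require Import all_boot all_order all_algebra.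
From mathcomp Require Import boolp classical_sets reals interval_inference convex.

Local Open Scope classical_set_scope.
Local Open Scope ring_scope.

Import Order.TTheory GRing.Theory Num.Theory.

(** Both Perron equations write [w] as [A *m x] with [x] entrywise positive, that
    is, as a positive combination of columns of [A]. Each column of [A] is
    efficient, because its consistent matrix agrees with [A] in one whole column,
    and a convex [efficient_set A], being invariant under positive scaling, is
    closed under positive combinations. *)

Lemma mul_invTE (R : realType) (n : nat) (w : 'cV[R]_n) i j :
  (w *m invT w) i j = w i 0 / w j 0.
Proof. by rewrite mxE big_ord1 !mxE. Qed.

Lemma efficient_col (R : realType) (n : nat) (A : 'M[R]_n) (k : 'I_n) :
  reciprocal_mx A -> efficient A (col k A).
Proof.
move=> [Apos Arec]; split=> [i|v vpos dom]; first by rewrite mxE.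
(* Reciprocity at [(k, k)] only gives [A k k ^+ 2 = 1]; positivity selects the root [1]. *)
have Akk : A k k = 1.
  apply/eqP; rewrite -(eqrXn2 (n := 2)) ?ler01 ?ltW // expr1n expr2.
  by rewrite {2}Arec div1r divff // gt_eqF.
exists (v k 0); apply/matrixP=> i j; rewrite ord1 !mxE.
(* Since [A k k = 1], the bound at [(i, k)] is [0], which forces [A i k = v i 0 / v k 0]. *)
have := dom i k.
rewrite !mxE !big_ord1 !mxE Akk invr1 mulr1 subrr normr0 normr_le0 subr_eq0.
by move=> /eqP ->; rewrite mulrC divfK // gt_eqF.
Qed.

Lemma mul_invT_scale (R : realType) (n : nat) (c : R) (w : 'cV[R]_n) :
  c != 0 -> (c *: w) *m invT (c *: w) = w *m invT w.
Proof.
move=> c0; apply/matrixP=> i j; rewrite !mul_invTE !mxE.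
by rewrite invfM mulrACA divff // mul1r.
Qed.

(** Apart from positivity, efficiency sees [w] only through [w *m invT w] and its direction, and
    scaling changes neither. *)
Lemma efficient_scale (R : realType) (n : nat) (A : 'M[R]_n) (c : R)
    (w : 'cV[R]_n) : 0 < c -> efficient A w -> efficient A (c *: w).
Proof.
move=> c0 [wpos weff]; split=> [i|v vpos]; first by rewrite mxE mulr_gt0.
rewrite mul_invT_scale ?gt_eqF // => dom; have [d ->] := weff v vpos dom.
by exists (d / c); rewrite scalerA divfK // gt_eqF.
Qed.

(** Convexity yields the midpoint of [u] and [v]; doubling it gives the sum. *)
Lemma efficient_add (R : realType) (n : nat) (A : 'M[R]_n) (u v : 'cV[R]_n) :
  convex_set (efficient_set A) ->
  efficient A u -> efficient A v -> efficient A (u + v).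
Proof.
move=> cvxA uA vA.
have half0 : 0 <= (2^-1 : R) by rewrite invr_ge0 ler0n.
have half1 : (2^-1 : R) <= 1 by rewrite invf_le1 ?ltr0n // ler1n.
have := cvxA u v (Itv01 half0 half1); rewrite !inE => /(_ uA vA) mid.
have -> : u + v = 2 *: (2^-1 *: u + (1 - 2^-1) *: v).
  rewrite scalerDr !scalerA mulrBr mulr1 divff ?pnatr_eq0 // scale1r.
  by rewrite (addrK 1 1 : 2 - 1 = 1) scale1r.
exact: efficient_scale _ _ _ _ _ (ltr0n _ 2) mid.
Qed.

Lemma mulmx_pos (R : realType) (n : nat) (M : 'M[R]_n) (x : 'cV[R]_n) :
  (forall i j, 0 < M i j) -> vec_pos x -> vec_pos (M *m x).
Proof.
(* [M] is square, so [i] is also a column index, and its term makes the sum strictly positive. *)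
move=> Mpos xpos i; rewrite mxE (bigD1 i) //= ltr_wpDr ?mulr_gt0 //.
by apply: sumr_ge0 => j _; rewrite ltW // mulr_gt0.
Qed.

Lemma efficient_mulmx_pos (R : realType) (n : nat) (A : 'M[R]_n) (x : 'cV[R]_n) :
  reciprocal_mx A -> convex_set (efficient_set A) -> vec_pos x ->
  efficient A (A *m x).
Proof.
move=> Arec cvxA xpos; have [Apos _] := Arec.
have Ax_sum : A *m x = \sum_k x k 0 *: col k A.
  apply/matrixP=> i j; rewrite ord1 mxE summxE.
  by apply: eq_bigr => k _; rewrite !mxE mulrC.
(* The zero alternative lets the induction start from the empty sum. *)
have [Ax0|//] : A *m x = 0 \/ efficient A (A *m x).
  rewrite Ax_sum; elim/big_rec: _ => [|k y _ [->|yA]]; [by left|right|right].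
    by rewrite addr0; apply: efficient_scale (xpos k) (efficient_col _ _ _ _ Arec).
  apply: efficient_add yA => //.
  exact: efficient_scale (xpos k) (efficient_col _ _ _ _ Arec).
(* A vector both zero and entrywise positive has no entries, so proportionality is vacuous here. *)
have Axpos := mulmx_pos _ _ _ _ Apos xpos; split=> // v _ _.
by exists 1; apply/matrixP=> i; have := Axpos i; rewrite Ax0 mxE ltxx.
Qed.

(* Positivity of [w] and [A *m x] forces [0 < r], except when [n = 0]. *)
Lemma efficient_of_mulmx_eq_scale (R : realType) (n : nat) (A : 'M[R]_n) (r : R)
    (x w : 'cV[R]_n) :
  reciprocal_mx A -> convex_set (efficient_set A) -> vec_pos x -> vec_pos w ->
  A *m x = r *: w -> efficient A w.
Proof.
move=> Arec cvxA xpos wpos Ax; split=> // v vpos dom.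
have := efficient_mulmx_pos _ _ _ _ Arec cvxA xpos; rewrite Ax => -[rwpos rweff].
have [i j|d ->] := rweff v vpos; last by exists (d * r); rewrite scalerA.
have := rwpos i; rewrite mxE pmulr_lgt0 // => r0.
by rewrite mul_invT_scale ?gt_eqF.
Qed.

Theorem corollary8 (R : realType) (n : nat) (A : 'M[R]_n)
    (hA : reciprocal_mx A) (hconv : convex_set (efficient_set A)) :
  (forall w : 'cV[R]_n, perron_vector (A *m A^T) w -> efficient_set A w) /\
  (forall w : 'cV[R]_n, perron_vector A w -> efficient_set A w).
Proof.
split=> w [wpos wE].
(* Regrouped as [A *m (A^T *m w)], the product has the positive vector [A^T *m w] in the role of
   [x]. *)
- rewrite -mulmxA in wE.
  apply: (efficient_of_mulmx_eq_scale _ _ _ _ _ _ hA hconv _ wpos wE).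
  by apply: mulmx_pos wpos => i j; rewrite mxE; case: hA.
- exact: (efficient_of_mulmx_eq_scale _ _ _ _ _ _ hA hconv wpos wpos wE).
Qed.
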